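(* $gr^{(2)}=GL_n(L)^{(2)}\cdot H_n^{(0)}$, i.e. a subspace $W\subset H_n$ belongs to $gr^{(2)}$ if and only if $W=g(t)H_n^{(0)}$ for some $g(t)\in GL_n(L)^{(2)}$.
   Context: Let $e_1,\dots,e_n$ be the standard basis of $\mathbb{C}^n$ and $H_n=\mathbb{C}^n((t))$ the space of formal Laurent series $\sum_jc_jt^j$, $c_j\in\mathbb{C}^n$, $c_j=0$ for $j\ll0$. For $1\le j\le n$, $k\in\mathbb{Z}$ put $v_{-n(k+1)+j-\frac12}:=e_jt^k$, and for $j\in\mathbb{Z}$ let $H_n^{(j)}$ be the space of (possibly infinite) sums $\sum_{m<j}b_mv_m$; in particular $H_n^{(0)}=\mathbb{C}^n[[t]]$. Let $Gr_0$ be the set of linear subspaces $W\subset H_n$ such that for all sufficiently negative $j$ one has $H_n^{(j)}\subset W$ and $\dim W/H_n^{(j)}=-j$, and $gr_0=\{W\in Gr_0: tW\subset W\}$. Define the skew-symmetric bilinear form on $H_n$ by $\langle u(t),v(t)\rangle=i\,\mathrm{Res}_t\sum_{a=1}^nu_a(t)v_a(-t)$, where $u_a,v_a$ are the components and $\mathrm{Res}_t\sum a_it^i=a_{-1}$. Put $Gr^{(2)}=\{W\in Gr_0:\langle u,v\rangle=0\ \forall u,v\in W\}$ and $gr^{(2)}=gr_0\cap Gr^{(2)}$. Let $L=\mathbb{C}[t,t^{-1}]$, $GL_n(L)$ the group of invertible $n\times n$ matrices over $L$ acting on $H_n$ by multiplication, and $GL_n(L)^{(2)}=\{A(t)\in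 GL_n(L): A(-t)=(A(t)^T)^{-1}\}$ the twisted loop group. *)

(* Defs.v *)
From HB Require Import structures.
From mathcomp Require Import all_boot all_order all_algebra.
From mathcomp Require Import reals.
From mathcomp Require Import complex.
Set Implicit Arguments.
Unset Strict Implicit.
Unset Printing Implicit Defensive.
Import Order.TTheory GRing.Theory Num.Theory.
Local Open Scope ring_scope.

Section Defs.
Variables (R : realType) (n : nat).
Local Notation C := (R[i]).

(* A candidate element of H_n = C^n((t)): f k a = a-th component of the
   coefficient of t^k (components indexed 0..n-1, i.e. e_{a+1}). *)
Definition LS := int -> 'I_n -> C.

Definition laurent (f : LS) : Prop :=
  exists N : int, forall k, k < N -> forall a, f k a = 0.

(* H_n^{(j)}: sums of v_m, m < j, where e_{a+1} t^k = v_{-n(k+1)+a+1/2};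
   -n(k+1)+a+1/2 < j  <->  -n(k+1)+a < j  (integers). *)
Definition Hj (j : int) (f : LS) : Prop :=
  forall k (a : 'I_n), f k a != 0 -> - ((n%:Z) * (k + 1)) + (a%:Z) < j.

Definition lincomb d (c : 'I_d -> C) (w : 'I_d -> LS) : LS :=
  fun k a => \sum_(i < d) c i * w i k a.

Definition subspace (W : LS -> Prop) : Prop :=
  (forall f, W f -> laurent f) /\ W (fun _ _ => 0) /\
  (forall f g, W f -> W g -> W (fun k a => f k a + g k a)) /\
  (forall (c : C) f, W f -> W (fun k a => c * f k a)).

Definition quot_dim (W : LS -> Prop) (j : int) (d : nat) : Prop :=
  exists w : 'I_d -> LS,
    (forall i, W (w i)) /\
    (forall c : 'I_d -> C, Hj j (lincomb c w) -> forall i, c i = 0) /\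
    (forall f, W f -> exists c : 'I_d -> C,
        Hj j (fun k a => f k a - lincomb c w k a)).

Definition Gr0 (W : LS -> Prop) : Prop :=
  subspace W /\
  exists N : nat, forall m : nat, (N <= m)%N ->
    (forall f, Hj (- (m%:Z)) f -> W f) /\ quot_dim W (- (m%:Z)) m.

Definition tmul (f : LS) : LS := fun k a => f (k - 1) a.

Definition gr0 (W : LS -> Prop) : Prop :=
  Gr0 W /\ (forall f, W f -> W (tmul f)).

(* i * Res_t sum_a u_a(t) v_a(-t), computed on the window p in [-N, N-1]
   of exponents of u (then q = -1-p is in [-N, N-1] too); this is the exact
   value whenever u and v vanish below -N. *)
Definition res_form_window (N : nat) (u v : LS) : C :=
  'i%C * \sum_(a < n) \sum_(i < (N + N)%N)
     (let p : int := i%:Z - N%:Z in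
      let q : int := - 1 - p in
      u p a * ((-1) ^ q * v q a)).

Definition form_zero (u v : LS) : Prop :=
  forall N : nat,
    (forall k, k < - (N%:Z) -> forall a, u k a = 0) ->
    (forall k, k < - (N%:Z) -> forall a, v k a = 0) ->
    res_form_window N u v = 0.

Definition Gr2 (W : LS -> Prop) : Prop :=
  Gr0 W /\ (forall u v, W u -> W v -> form_zero u v).

Definition gr2 (W : LS -> Prop) : Prop := gr0 W /\ Gr2 W.

(* An n x n matrix over L = C[t, t^-1], written t^{-lmx_sh} * lmx_mat(t)
   with lmx_mat a matrix of polynomials; every element of M_n(L) has this form. *)
Record lmx := LMx { lmx_sh : nat; lmx_mat : 'M[{poly C}]_n }.

(* A(t) in GL_n(L): there is B(t) = t^{-m'} Q(t) with A B = B A = 1 *)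
Definition in_GLnL (A : lmx) : Prop :=
  exists (m' : nat) (Q : 'M[{poly C}]_n),
    lmx_mat A *m Q = ('X^(lmx_sh A + m'))%:M /\
    Q *m lmx_mat A = ('X^(lmx_sh A + m'))%:M.

Definition mx_negt (P : 'M[{poly C}]_n) : 'M[{poly C}]_n :=
  map_mx (fun p : {poly C} => p \Po (- 'X)) P.

(* A(-t) = (A(t)^T)^{-1}, with A(t) = t^{-m} P(t):
   A(-t) = (-1)^m t^{-m} P(-t), A(t)^T = t^{-m} P(t)^T, and
   A(-t) A(t)^T = 1 = A(t)^T A(-t) after multiplying by t^{2m}. *)
Definition twisted (A : lmx) : Prop :=
  in_GLnL A /\
  ((-1) ^+ lmx_sh A) *: (mx_negt (lmx_mat A) *m (lmx_mat A)^T)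
     = ('X^(lmx_sh A + lmx_sh A))%:M /\
  ((-1) ^+ lmx_sh A) *: ((lmx_mat A)^T *m mx_negt (lmx_mat A))
     = ('X^(lmx_sh A + lmx_sh A))%:M.

Definition lmx_act (A : lmx) (f : LS) : LS :=
  fun k a => \sum_(b < n) \sum_(j < size (lmx_mat A a b))
     (lmx_mat A a b)`_j * f (k + (lmx_sh A)%:Z - j%:Z) b.

End Defs.

(* Main.v *)
Require Import Defs.
From HB Require Import structures.
From mathcomp Require Import all_boot all_order all_algebra.
From mathcomp Require Import boolp reals.
From mathcomp Require Import complex.
From mathcomp Require Import zify ring.
Set Implicit Arguments.
Unset Strict Implicit.
Unset Printing Implicit Defensive.
Import Order.TTheory GRing.Theory Num.Theory.
Local Open Scope ring_scope.

(* Counting dimensions in t^-N H_n^(0) / t^N H_n^(0), the condition on dim W / H_n^(j)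
   says that an isotropic W is its own orthogonal, a property which twisted loops
   preserve and which H_n^(0) has.  Conversely, if W is self-orthogonal, t-stable
   and not contained in H_n^(0), pick w = t^-1 y + z + ... in W.  Isotropy of w and
   t w gives y.y = 0, so with x = conj y / |y|^2 (thus x.x = 0 and x.y = 1) and
   c = y.z the vectors y -> t^-1 y + c x, x -> - t x define a twisted loop g whose
   image g H_n^(0) contains both w and the intersection of W with H_n^(0).  Hence
   g^-1 W is closer to H_n^(0) than W, and one concludes by induction. *)

(** * Polynomials in [t] acting on two-sided scalar sequences by convolution *)

Section PolyAction.
Variable F : fieldType.
Implicit Types (p q : {poly F}) (u v : int -> F) (k : int) (c : F).

(** In [lmx_act A f], the inner sum for a column [b] unfolds to [act] of the matrix entry on
    [f^~ b], taken at [k + lmx_sh A]; later proofs pass between the two by conversion. *)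
Definition act p u : int -> F := fun k => \sum_(j < size p) p`_j * u (k - j%:Z).

Definition shift u : int -> F := fun k => u (k - 1).

(** Coefficients beyond the size are zero, so one range of summation serves polynomials of different
    sizes. *)
Lemma act_widen m p u k : (size p <= m)%N ->
  act p u k = \sum_(j < m) p`_j * u (k - j%:Z).
Proof.
move=> le_pm; rewrite /act (big_ord_widen m (fun j => p`_j * u (k - j%:Z))) //.
rewrite big_mkcond; apply: eq_bigr => j _.
by case: ltnP => // le_pj; rewrite nth_default ?mul0r.
Qed.

Lemma actD p q u k : act (p + q) u k = act p u k + act q u k.
Proof.
have le_m := size_polyD p q.
rewrite (act_widen _ _ le_m) (@act_widen (maxn (size p) (size q)) p) ?leq_maxl //.
rewrite (@act_widen (maxn (size p) (size q)) q) ?leq_maxr // -big_split /=.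
by apply: eq_bigr => j _; rewrite coefD mulrDl.
Qed.

Lemma actZ c p u k : act (c *: p) u k = c * act p u k.
Proof.
rewrite (act_widen _ _ (size_scale_leq c p)) mulr_sumr.
by apply: eq_bigr => j _; rewrite coefZ mulrA.
Qed.

Lemma act0 u k : act 0 u k = 0.
Proof. by rewrite /act size_poly0 big_ord0. Qed.

Lemma actC c u k : act c%:P u k = c * u k.
Proof.
by rewrite (act_widen _ _ (size_polyC_leq1 c)) big_ord1 coefC eqxx subr0.
Qed.

Lemma actMX p u : act (p * 'X) u = act p (shift u).
Proof.
apply/funext => k.
have le_m : (size (p * 'X)%R <= (size p).+1)%N.
  by apply: leq_trans (size_polyMleq _ _) _; rewrite size_polyX addn2.
rewrite (act_widen _ _ le_m) big_ord_recl coefMX mul0r add0r /act; apply: eq_bigr => j _.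
by rewrite coefMX /= /shift; congr (_ * u _); rewrite /bump /=; lia.
Qed.

Lemma act_sum (I : Type) (r : seq I) (P : pred I) (f : I -> {poly F}) u k :
  act (\sum_(i <- r | P i) f i) u k = \sum_(i <- r | P i) act (f i) u k.
Proof.
by elim/big_rec2: _ => [|i y p _ <-]; rewrite ?act0 ?actD.
Qed.

Lemma actr_sum (I : Type) (r : seq I) (P : pred I) p (f : I -> int -> F) k :
  act p (fun l => \sum_(i <- r | P i) f i l) k
  = \sum_(i <- r | P i) act p (f i) k.
Proof.
rewrite /act exchange_big /=; apply: eq_bigr => j _.
by rewrite mulr_sumr.
Qed.

Lemma actrD p u v k : act p (fun l => u l + v l) k = act p u k + act p v k.
Proof. by rewrite /act -big_split; apply: eq_bigr => j _; rewrite mulrDr. Qed.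

Lemma actrZ p c u k : act p (fun l => c * u l) k = c * act p u k.
Proof. by rewrite /act mulr_sumr; apply: eq_bigr => j _; rewrite mulrCA. Qed.

Lemma act_translate p u (s k : int) :
  act p (fun l => u (l + s)) k = act p u (k + s).
Proof. by apply: eq_bigr => j _; congr (_ * u _); rewrite addrAC. Qed.

Lemma actX p u k : act (p * 'X) u k = act p u (k - 1).
Proof. by rewrite actMX -act_translate. Qed.

(** Horner induction on [p]; [u] stays general because a factor ['X] becomes a shift of the
    sequence. *)
Lemma actM p q u : act (p * q) u = act p (act q u).
Proof.
elim/poly_ind: p u => [|p c IH] u; apply/funext => k; first by rewrite mul0r !act0.
rewrite mulrDl actD mul_polyC actZ mulrAC actMX IH actD actC actMX.
congr (act p _ k + _); apply/funext => l.
by rewrite [LHS](act_translate q u (- 1) l).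
Qed.

Lemma actXn m u k : act 'X^m u k = u (k - m%:Z).
Proof.
elim: m k => [|m IH] k; first by rewrite expr0 actC mul1r subr0.
by rewrite exprSr actX IH; congr u; lia.
Qed.

Lemma act_vanish p u (s : int) :
  (forall k, k < s -> u k = 0) -> forall k, k < s -> act p u k = 0.
Proof.
by move=> u0 k k_lt; apply: big1 => j _; rewrite u0 ?mulr0 //; lia.
Qed.

End PolyAction.

(** * The residue pairing of scalar sequences, computed on a finite window of exponents *)

Section ScalarForm.
Variable F : fieldType.
Implicit Types (p q : {poly F}) (u v : int -> F) (N M : nat).

Definition res_window N u v : F :=
  \sum_(i < (N + N)%N)
     (let p : int := i%:Z - N%:Z in
      let q : int := - 1 - p in
      u p * ((-1) ^ q * v q)).

Lemma res_windowDl N u1 u2 v :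
  res_window N (fun k => u1 k + u2 k) v = res_window N u1 v + res_window N u2 v.
Proof. by rewrite -big_split; apply: eq_bigr => i _; rewrite /= mulrDl. Qed.

Lemma res_windowDr N u v1 v2 :
  res_window N u (fun k => v1 k + v2 k) = res_window N u v1 + res_window N u v2.
Proof. by rewrite -big_split; apply: eq_bigr => i _; rewrite /= !mulrDr. Qed.

Lemma res_windowZl N c u v :
  res_window N (fun k => c * u k) v = c * res_window N u v.
Proof. by rewrite mulr_sumr; apply: eq_bigr => i _; rewrite /= -mulrA. Qed.

Lemma res_windowZr N c u v :
  res_window N u (fun k => c * v k) = c * res_window N u v.
Proof.
by rewrite mulr_sumr; apply: eq_bigr => i _ /=; rewrite !(mulrCA _ c).
Qed.

Lemma res_window_suml N (I : finType) (f : I -> int -> F) v :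
  res_window N (fun k => \sum_i f i k) v = \sum_i res_window N (f i) v.
Proof. by rewrite exchange_big; apply: eq_bigr => i _ /=; rewrite mulr_suml. Qed.

Lemma res_window_sumr N (I : finType) (f : I -> int -> F) u :
  res_window N u (fun k => \sum_i f i k) = \sum_i res_window N u (f i).
Proof.
by rewrite exchange_big; apply: eq_bigr => i _ /=; rewrite !mulr_sumr.
Qed.

(** Two exponents of [u] enter the window: [- N - 1], where [u] vanishes, and [N], whose partner
    [- 1 - N] is a zero of [v]. *)
Lemma res_windowS N u v :
  (forall k, k < - N%:Z -> u k = 0) -> (forall k, k < - N%:Z -> v k = 0) ->
  res_window N.+1 u v = res_window N u v.
Proof.
move=> u0 v0; rewrite /res_window addSnnS -addSnnS addnS addSn.
rewrite big_ord_recl big_ord_recr /= u0 ?mul0r ?add0r; last by lia.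
rewrite [X in _ + X](_ : _ = 0) ?addr0; last by rewrite v0 ?mulr0 /bump //=; lia.
apply: eq_bigr => i _.
by have -> : (bump 0 i)%:Z - N.+1%:Z = i%:Z - N%:Z by rewrite /bump /=; lia.
Qed.

Lemma res_window_widen N M u v : (N <= M)%N ->
  (forall k, k < - N%:Z -> u k = 0) -> (forall k, k < - N%:Z -> v k = 0) ->
  res_window M u v = res_window N u v.
Proof.
move=> /subnK <-; elim: (M - N)%N => [|d IH] u0 v0 //.
by rewrite addSn res_windowS ?IH // => k k_lt; [apply: u0 | apply: v0]; lia.
Qed.

(** Multiplication by t is skew-adjoint because the second argument enters as v(-t). The two
    hypotheses remove the one boundary term on each side. *)
Lemma res_window_shift N u v :
  u (- 1 - N%:Z) = 0 -> v (- 1 - N%:Z) = 0 ->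
  res_window N (shift u) v = - res_window N u (shift v).
Proof.
case: N => [|N] u0 v0; first by rewrite /res_window !big_ord0 oppr0.
rewrite /res_window /shift addSn big_ord_recl big_ord_recr /=.
rewrite [X in u X](_ : _ = - 1 - N.+1%:Z) ?u0 ?mul0r ?add0r; last by lia.
rewrite [X in _ = - (_ + X)](_ : _ = 0) ?addr0; last first.
  by rewrite [X in v X](_ : _ = - 1 - N.+1%:Z) ?v0 ?mulr0 //; lia.
rewrite -sumrN; apply: eq_bigr => i _.
rewrite -mulrN -mulNr; congr (u _ * (_ * v _)); rewrite /bump /=; try lia.
rewrite [X in - ((-1) ^ X)](_ : _ = - 1 - ((1 + i)%N%:Z - N.+1%:Z) + 1); last by lia.
by rewrite [in RHS]expfzDr ?oppr_eq0 ?oner_eq0 // expr1z mulrN1 opprK.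
Qed.

(** Since ['X] is skew-adjoint, Horner induction turns p(t) into p(-t). *)
Lemma res_window_act N p u v :
  (forall k, k < - N%:Z -> u k = 0) -> (forall k, k < - N%:Z -> v k = 0) ->
  res_window N (act p u) v = res_window N u (act (p \Po - 'X) v).
Proof.
move=> u0 v0; elim/poly_ind: p u u0 => [|p c IH] u u0.
  by rewrite comp_poly0 /res_window !big1 // => i _; rewrite /= act0 ?mulr0 ?mul0r.
rewrite comp_polyD comp_polyM comp_polyX comp_polyC mulrN.
have -> : act (p * 'X + c%:P) u = fun k => act p (shift u) k + c * u k.
  by apply/funext => k; rewrite actD actMX actC.
rewrite res_windowDl res_windowZl IH; last by move=> k k_lt; apply: u0; lia.
rewrite res_window_shift; first last.
- by apply: (act_vanish _ v0); lia.
- by apply: u0; lia.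
have -> : act (- ((p \Po - 'X) * 'X) + c%:P) v
   = fun k => -1 * shift (act (p \Po - 'X) v) k + c * v k.
  by apply/funext => k; rewrite actD actC -scaleN1r actZ actX.
by rewrite res_windowDr !res_windowZr mulN1r.
Qed.

(** The adjoint of t^-s is (-t)^-s. Translation deepens the poles by [s], hence the room required in
    [M]. *)
Lemma res_window_translate s N M u v : (N + s <= M)%N ->
  (forall k, k < - N%:Z -> u k = 0) -> (forall k, k < - N%:Z -> v k = 0) ->
  res_window M (fun k => u (k + s%:Z)) v
  = (-1) ^+ s * res_window M u (fun k => v (k + s%:Z)).
Proof.
elim: s N v => [|s IH] N v le_M u0 v0.
  rewrite expr0 mul1r; congr res_window; by apply/funext => k; rewrite addr0.
(* This form lets [res_window_shift] be read backwards. The translate of [v] has one more order of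
   pole, so the induction hypothesis is used at [N.+1]. *)
have -> : v = shift (fun k => v (k + 1)).
  by apply/funext => k; rewrite /shift subrK.
rewrite -[res_window M _ (shift _)]opprK -res_window_shift; first last.
- by apply: v0; lia.
- by apply: u0; lia.
have -> : shift (fun k => u (k + s.+1%:Z)) = fun k => u (k + s%:Z).
  by apply/funext => k; rewrite /shift; congr u; lia.
rewrite (IH N.+1) => [||k k_lt|k k_lt]; [|lia|by apply: u0; lia|by apply: v0; lia].
rewrite exprS mulN1r mulNr; congr (- (_ * res_window _ _ _)).
by apply/funext => k; rewrite /shift; congr v; lia.
Qed.

End ScalarForm.

(** * Loop matrices, their adjoints for the residue form, and self-orthogonal subspaces *)

Section LoopAction.
Variables (R : realType) (n : nat).
Local Notation C := (R[i]).
Local Notation LS := (LS R n).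
Local Notation lmx := (lmx R n).
Implicit Types (f h u v w : LS) (A B g : lmx) (W : LS -> Prop).

Definition vanish (s : int) f := forall k, k < s -> forall a, f k a = 0.

Lemma vanish_le (s s' : int) f : s' <= s -> vanish s f -> vanish s' f.
Proof. by move=> le_s f0 k k_lt; apply: f0; lia. Qed.

(** As [a] ranges below [n], the index -n(k+1)+a fills one block of length [n] for each [k]; at
    multiples of [n] the filtration is therefore by powers of t. *)
Lemma Hj_vanish (s : int) f : Hj (- (s * n%:Z)) f <-> vanish s f.
Proof.
split=> [Hf k k_lt a | f0 k a].
  apply/eqP; apply: contraTT k_lt => /Hf.
  by have := ltn_ord a; rewrite -leNgt; nia.
by case: (ltP k s) => [/f0 -> /[!eqxx]//|]; have := ltn_ord a; nia.
Qed.

Lemma Hj0_vanish f : Hj 0 f <-> vanish 0 f.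
Proof. by rewrite -Hj_vanish mul0r oppr0. Qed.

Lemma laurent_vanish f : laurent f -> exists N : nat, vanish (- N%:Z) f.
Proof. by case=> s f0; exists `|s|%N; apply: vanish_le f0; lia. Qed.

Lemma vanish_laurent s f : vanish s f -> laurent f.
Proof. by move=> f0; exists s. Qed.

Lemma laurent_common u v : laurent u -> laurent v ->
  exists N : nat, vanish (- N%:Z) u /\ vanish (- N%:Z) v.
Proof.
move=> /laurent_vanish[N u0] /laurent_vanish[M v0]; exists (maxn N M).
by split; [apply: vanish_le u0 | apply: vanish_le v0]; lia.
Qed.

Definition res_form N u v : C := \sum_(a < n) res_window N (u^~ a) (v^~ a).

Lemma res_form_widen N M u v : (N <= M)%N ->
  vanish (- N%:Z) u -> vanish (- N%:Z) v -> res_form M u v = res_form N u v.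
Proof.
by move=> le_NM u0 v0; apply: eq_bigr => a _; apply: res_window_widen => // k k_lt;
  [apply: u0 | apply: v0].
Qed.

(** All admissible windows give the same value, seen by comparing two of them with the larger one;
    and the factor i is nonzero. *)
Lemma form_zeroP N u v : vanish (- N%:Z) u -> vanish (- N%:Z) v ->
  form_zero u v <-> res_form N u v = 0.
Proof.
have i_neq0 : ('i%C : C) != 0 by rewrite eq_complex /= oner_eq0 andbF.
move=> u0 v0; split=> [/(_ N u0 v0)/eqP|uv0 M u1 v1].
  by rewrite mulf_eq0 (negPf i_neq0) => /eqP.
apply/eqP; rewrite mulf_eq0 (negPf i_neq0) /= -[X in X == 0]/(res_form M u v).
rewrite -(res_form_widen (leq_maxr N M)) // (res_form_widen (leq_maxl N M)) //.
exact/eqP.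
Qed.

Definition mono (l : int) (b : 'I_n) : LS :=
  fun k a => ((k == l) && (a == b))%:R.

Lemma vanish_mono l b : vanish l (mono l b).
Proof. by move=> k k_lt a; rewrite /mono lt_eqF. Qed.

(** A monomial isolates a single coefficient of [u], up to sign and i; this converts orthogonality
    into bounds on poles. *)
Lemma form_zero_mono u l b :
  laurent u -> form_zero u (mono l b) -> u (- 1 - l) b = 0.
Proof.
move=> /laurent_vanish[N u0].
have u1 : vanish (- (N + `|l|.+1)%N%:Z) u by apply: vanish_le u0; lia.
have m0 : vanish (- (N + `|l|.+1)%N%:Z) (mono l b).
  by apply: vanish_le (@vanish_mono l b); lia.
move=> /(form_zeroP u1 m0).
(* The position of the exponent [- 1 - l] in a window that starts at [- (N + |l| + 1)]. *)
have lt_i : (absz ((N + `|l|.+1)%N%:Z - 1 - l)%R < (N + `|l|.+1) + (N + `|l|.+1))%N.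
  by lia.
rewrite /res_form (bigD1 b) //= [X in _ + X]big1 ?addr0; last first.
  move=> a ab; apply: big1 => i _ /=.
  by rewrite /mono (negPf ab) andbF !mulr0.
rewrite /res_window (bigD1 (Ordinal lt_i)) //= [X in _ + X]big1 ?addr0; last first.
  move=> i; rewrite -val_eqE /= => ii.
  by rewrite /mono (_ : (_ == l) = false) ?mulr0 //; lia.
rewrite /mono eqxx andbT (_ : (_ == l) = true); last by lia.
rewrite mulr1 => /eqP; rewrite mulf_eq0 expfz_eq0 oppr_eq0 oner_eq0 andbF orbF.
by move=> /eqP <-; congr u; lia.
Qed.

Lemma vanish_act A s f : vanish s f -> vanish (s - (lmx_sh A)%:Z) (lmx_act A f).
Proof.
move=> f0 k k_lt a; apply: big1 => b _.
by apply: (@act_vanish _ _ (f^~ b) s); [move=> l /f0|lia].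
Qed.

Lemma laurent_act A f : laurent f -> laurent (lmx_act A f).
Proof. by case=> s /(vanish_act (A := A))/vanish_laurent. Qed.

Lemma lmx_actD A f h : lmx_act A (fun k a => f k a + h k a)
  = fun k a => lmx_act A f k a + lmx_act A h k a.
Proof.
apply/funext => k; apply/funext => a; rewrite -big_split; apply: eq_bigr => b _.
exact: (actrD _ (f^~ b) (h^~ b)).
Qed.

Lemma lmx_actZ A (c : C) f : lmx_act A (fun k a => c * f k a)
  = fun k a => c * lmx_act A f k a.
Proof.
apply/funext => k; apply/funext => a; rewrite mulr_sumr; apply: eq_bigr => b _.
exact: (actrZ _ c (f^~ b)).
Qed.

Lemma lmx_act0 A : lmx_act A (fun _ _ => 0) = fun _ _ => 0.
Proof.
apply/funext => k; apply/funext => a; apply: big1 => b _.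
by apply: big1 => j _; rewrite mulr0.
Qed.

Lemma lmx_act_tmul A f : lmx_act A (tmul f) = tmul (lmx_act A f).
Proof.
apply/funext => k; apply/funext => a; apply: eq_bigr => b _.
apply: eq_bigr => j _; congr (_ * f _ _); lia.
Qed.

Lemma lmx_act_lincomb A d (c : 'I_d -> C) (w : 'I_d -> LS) :
  lmx_act A (lincomb c w) = lincomb c (fun i => lmx_act A (w i)).
Proof.
apply/funext => k; apply/funext => a; rewrite /lincomb /lmx_act.
under [RHS]eq_bigr => i _ do rewrite mulr_sumr.
rewrite exchange_big; apply: eq_bigr => b _.
rewrite [LHS](actr_sum _ _ _ (fun i l => c i * w i l b)).
by apply: eq_bigr => i _; rewrite (actrZ _ _ ((w i)^~ b)).
Qed.

Definition lmx_mul A B : lmx :=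
  LMx (lmx_sh A + lmx_sh B) (lmx_mat A *m lmx_mat B).

Lemma lmx_actM A B f : lmx_act (lmx_mul A B) f = lmx_act A (lmx_act B f).
Proof.
apply/funext => k; apply/funext => a.
transitivity (\sum_b \sum_c act (lmx_mat A a c) (act (lmx_mat B c b) (f^~ b))
                 (k + (lmx_sh A)%:Z + (lmx_sh B)%:Z)).
  apply: eq_bigr => b _; rewrite -[LHS]/(act _ (f^~ b) _) mxE act_sum /=.
  by apply: eq_bigr => c _; rewrite actM PoszD addrA.
rewrite exchange_big; apply: eq_bigr => c _.
rewrite -[RHS]/(act _ (fun l => \sum_b act (lmx_mat B c b) (f^~ b) (l + (lmx_sh B)%:Z)) _).
by rewrite actr_sum; apply: eq_bigr => b _; rewrite act_translate.
Qed.

(** A loop has many presentations t^-s P(t); these are the presentations of the identity that arise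
    when a loop is multiplied by its inverse. *)
Lemma lmx_act_scalar s f :
  lmx_act (LMx s ('X^s)%:M) f = f.
Proof.
apply/funext => k; apply/funext => a.
rewrite /lmx_act (bigD1 a) //= [X in _ + X]big1 ?addr0 => [|b ba].
  by rewrite -[LHS]/(act _ (f^~ a) _) mxE eqxx actXn addrK.
by rewrite -[LHS]/(act _ (f^~ b) _) mxE eq_sym (negPf ba) act0.
Qed.

(** This is A(-t)^T, the sign coming from (-t)^-m with m = [lmx_sh A]. It is the adjoint of A for
    the residue form, and the inverse of A when A is twisted. *)
Definition lmx_adj A : lmx :=
  LMx (lmx_sh A) ((-1) ^+ lmx_sh A *: (mx_negt (lmx_mat A))^T).

Lemma mulmx_adj A : twisted A ->
  lmx_mul A (lmx_adj A) = LMx (lmx_sh A + lmx_sh A) ('X^(lmx_sh A + lmx_sh A))%:M.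
Proof.
case=> _ [E _]; rewrite /lmx_mul /lmx_adj /=; congr LMx.
by rewrite -[RHS]tr_scalar_mx -E [RHS]linearZ /= trmx_mul trmxK scalemxAr.
Qed.

Lemma mulmx_adjl A : twisted A ->
  lmx_mul (lmx_adj A) A = LMx (lmx_sh A + lmx_sh A) ('X^(lmx_sh A + lmx_sh A))%:M.
Proof.
case=> _ [_ E]; rewrite /lmx_mul /lmx_adj /=; congr LMx.
by rewrite -[RHS]tr_scalar_mx -E [RHS]linearZ /= trmx_mul trmxK scalemxAl.
Qed.

Lemma lmx_adjK A f : twisted A -> lmx_act A (lmx_act (lmx_adj A) f) = f.
Proof. by move=> tA; rewrite -lmx_actM mulmx_adj // lmx_act_scalar. Qed.

Lemma lmx_actK A f : twisted A -> lmx_act (lmx_adj A) (lmx_act A f) = f.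
Proof. by move=> tA; rewrite -lmx_actM mulmx_adjl // lmx_act_scalar. Qed.

(** A one-sided inverse up to a power of t is two-sided: if P Q = t^s, then (Q P - t^s) Q = 0, and Q
    can be cancelled through its adjugate because its determinant is nonzero in a domain. *)
Lemma twisted_of_left A :
  (-1) ^+ lmx_sh A *: (mx_negt (lmx_mat A) *m (lmx_mat A)^T)
    = ('X^(lmx_sh A + lmx_sh A))%:M -> twisted A.
Proof.
move=> E.
have comm (P Q : 'M[{poly C}]_n) s : P *m Q = ('X^s)%:M -> Q *m P = ('X^s)%:M.
  move=> PQ; have Q_reg : \det Q != 0.
    have : \det (P *m Q) != 0 by rewrite PQ det_scalar !expf_neq0 // polyX_eq0.
    by rewrite det_mulmx mulf_eq0 negb_or => /andP[].
  have : (Q *m P - ('X^s)%:M) *m Q = 0.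
    by rewrite mulmxBl -mulmxA PQ mul_mx_scalar mul_scalar_mx subrr.
  move=> /(congr1 (mulmx^~ (\adj Q))); rewrite mul0mx -mulmxA mul_mx_adj mul_mx_scalar.
  by move=> /eqP; rewrite scalemx_eq0 (negPf Q_reg) subr_eq0 => /eqP.
have E2 : (-1) ^+ lmx_sh A *: ((lmx_mat A)^T *m mx_negt (lmx_mat A))
    = ('X^(lmx_sh A + lmx_sh A))%:M.
  by rewrite scalemxAr; apply: comm; rewrite -scalemxAl.
(* The inverse loop is [lmx_adj A], with the same power of t in the denominator. *)
split=> //; exists (lmx_sh A), ((-1) ^+ lmx_sh A *: (mx_negt (lmx_mat A))^T).
split; rewrite -tr_scalar_mx.
  by rewrite -E [RHS]linearZ /= trmx_mul trmxK scalemxAr.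
by rewrite -E2 [RHS]linearZ /= trmx_mul trmxK scalemxAl.
Qed.

Lemma twistedM A B : twisted A -> twisted B -> twisted (lmx_mul A B).
Proof.
move=> [_ [EA _]] [_ [EB _]]; apply: twisted_of_left => /=.
rewrite {1}/mx_negt map_mxM -!/(mx_negt _) trmx_mul -mulmxA.
rewrite [X in _ *: (_ *m X)]mulmxA exprD -scalerA [X in _ *: X]scalemxAr.
rewrite [X in _ *m X]scalemxAl EB mul_scalar_mx -scalemxAr scalerA mulrC.
by rewrite -scalerA EA scale_scalar_mx -exprD; congr (('X^_)%:M); lia.
Qed.

Lemma twisted1 : twisted (LMx 0 1%:M : lmx).
Proof.
apply: twisted_of_left => /=; rewrite expr0 scale1r trmx1 mulmx1.
by rewrite /mx_negt map_mx1.
Qed.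

(** Entry by entry, [res_window_act] moves the polynomial and [res_window_translate] the
    denominator; the resulting sign is the one built into [lmx_adj]. *)
Lemma res_form_adj A N M u v : (N + lmx_sh A <= M)%N ->
  vanish (- N%:Z) u -> vanish (- N%:Z) v ->
  res_form M (lmx_act A u) v = res_form M u (lmx_act (lmx_adj A) v).
Proof.
move=> le_M u0 v0.
transitivity (\sum_a \sum_b (-1) ^+ lmx_sh A * res_window M (u^~ b)
   (fun k => act (lmx_mat A a b \Po - 'X) (v^~ a) (k + (lmx_sh A)%:Z))).
  apply: eq_bigr => a _.
  rewrite -[LHS]/(res_window _ (fun k => \sum_b
     act (lmx_mat A a b) (u^~ b) (k + (lmx_sh A)%:Z)) _) res_window_suml.
  apply: eq_bigr => b _; rewrite (res_window_translate le_M) => [|k k_lt|k k_lt].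
  - congr (_ * _); rewrite res_window_act => [|k k_lt|k k_lt].
    + by congr res_window; apply/funext => k; apply: (act_translate _ (v^~ a)).
    + by apply: u0; lia.
    + by apply: v0; lia.
  - by apply: (@act_vanish _ _ (u^~ b) (- N%:Z)) => // l l_lt; apply: u0.
  - exact: v0.
rewrite exchange_big; apply: eq_bigr => b _.
rewrite -[RHS]/(res_window _ _ (fun k => \sum_a
   act (lmx_mat (lmx_adj A) b a) (v^~ a) (k + (lmx_sh A)%:Z))) res_window_sumr.
apply: eq_bigr => a _; rewrite -res_windowZr; congr res_window.
apply/funext => k; rewrite !mxE -actZ; congr (act _ _ _).
by rewrite -mul_polyC rmorphXn rmorphN1.
Qed.

Lemma form_zero_act A u v : twisted A -> laurent u -> laurent v ->
  form_zero (lmx_act A u) (lmx_act A v) <-> form_zero u v.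
Proof.
move=> tA lu lv; have [N [u0 v0]] := laurent_common lu lv.
(* One [s] accounts for the poles of [lmx_act A v], the other for moving [A] across the pairing. *)
pose s := lmx_sh A; pose M := (N + s + s)%N.
have vM f : vanish (- N%:Z) f -> vanish (- (N + s)%N%:Z) (lmx_act A f).
  by move=> /(vanish_act (A := A)); apply: vanish_le; rewrite /s; lia.
have le_M f s' : s' <= (N + s)%N%:Z -> vanish (- s') f -> vanish (- M%:Z) f.
  by move=> le_s; apply: vanish_le; rewrite /M; lia.
rewrite (form_zeroP (le_M _ _ _ (vM _ u0)) (le_M _ _ _ (vM _ v0))) //.
rewrite (@res_form_adj _ (N + s)%N) ?lmx_actK //; [|by apply: vanish_le u0; lia|exact: vM].
by rewrite -form_zeroP //; [apply: le_M u0|apply: le_M v0]; lia.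
Qed.

(** A form of [gr2] without dimensions: the last two clauses make [W] equal to its own orthogonal, a
    condition that form-preserving loops transport directly. *)
Definition selfdual W :=
  [/\ subspace W, forall f, W f -> W (tmul f),
      forall u v, W u -> W v -> form_zero u v &
      forall f, laurent f -> (forall u, W u -> form_zero f u) -> W f].

(** The subspace is A^-1 W, written as a preimage so that membership needs no witness. Each clause
    is transported because A is linear, commutes with t, preserves the form and is invertible. *)
Lemma selfdual_pullback A W : twisted A -> selfdual W ->
  selfdual (fun f => W (lmx_act A f)).
Proof.
move=> tA [[Wl [W0 [WD WZ]]] Wt Wiso Wmax].
have Wl' f : W (lmx_act A f) -> laurent f.
  by move=> /Wl/(laurent_act (lmx_adj A)); rewrite lmx_actK.
split=> [|f Wf|u v Wu Wv|f lf fW].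
- split=> //; split; first by rewrite lmx_act0.
  split=> [f h Wf Wh|c f Wf]; first by rewrite lmx_actD; apply: WD.
  by rewrite lmx_actZ; apply: WZ.
- by rewrite lmx_act_tmul; apply: Wt.
- by rewrite -(form_zero_act tA) ?Wl' //; [apply: Wiso|apply: Wl'..].
- apply: Wmax; first exact: laurent_act.
  move=> u Wu; rewrite -[u](lmx_adjK u tA) form_zero_act //.
    by apply: fW; rewrite lmx_adjK.
  by apply: laurent_act; apply: Wl.
Qed.

(** For two power series the empty window is already admissible. Maximality follows by testing
    against the monomials of nonnegative exponent. *)
Lemma selfdual_vanish0 : selfdual (vanish 0 : LS -> Prop).
Proof.
split=> [|f f0 k k_lt a|u v u0 v0|f lf f_orth k k_lt a].
- split=> [f|]; first exact: vanish_laurent.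
  split=> //; split=> [f h f0 h0 k k_lt a|c f f0 k k_lt a].
    by rewrite f0 ?h0 ?addr0.
  by rewrite f0 ?mulr0.
- by apply: f0; lia.
- apply/(@form_zeroP 0) => //; apply: big1 => a _.
  by rewrite /res_window big_ord0.
- rewrite (_ : k = -1 - (-1 - k)); last by lia.
  apply: form_zero_mono => //; apply: f_orth.
  by apply: vanish_le (@vanish_mono _ _); lia.
Qed.

End LoopAction.

(** * Removing poles one direction at a time with explicit twisted loops *)

Section Descent.
Variables (R : realType) (n : nat).
Local Notation C := (R[i]).
Local Notation LS := (LS R n).
Local Notation lmx := (lmx R n).
Implicit Types (f h u v w : LS) (A B g : lmx) (W : LS -> Prop) (x y z : 'I_n -> C).

Lemma comp_polyN (p q : {poly C}) : (- p) \Po q = - (p \Po q).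
Proof. exact: raddfN. Qed.

(** Substituting -t for t twice is the identity, so the second twisting identity of [A] is the first
    one for its adjoint. *)
Lemma twisted_adj A : twisted A -> twisted (lmx_adj A).
Proof.
case=> _ [_ E]; apply: twisted_of_left => /=.
have -> : mx_negt ((-1) ^+ lmx_sh A *: (mx_negt (lmx_mat A))^T)
    = (-1) ^+ lmx_sh A *: (lmx_mat A)^T.
  apply/matrixP => a b; rewrite !mxE comp_polyM rmorphXn rmorphN1 /=.
  congr (_ * _); rewrite -comp_polyA.
  by rewrite comp_polyN comp_polyX opprK comp_polyXr.
rewrite linearZ /= trmxK -scalemxAl -scalemxAr scalerA -expr2 sqrr_sign scale1r.
exact: E.
Qed.

(** Bilinear, without conjugation, so a nonzero vector may be isotropic. *)
Definition dot x y : C := \sum_a x a * y a.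

Lemma dotC x y : dot x y = dot y x.
Proof. by apply: eq_bigr => a _; rewrite mulrC. Qed.

Definition outer x y : 'M[{poly C}]_n := \matrix_(a, b) (x a * y b)%:P.

Lemma outerM x y x' y' : outer x y *m outer x' y' = (dot y x')%:P *: outer x y'.
Proof.
apply/matrixP => a b; rewrite !mxE -polyCM mulr_suml rmorph_sum /=.
by apply: eq_bigr => k _; rewrite !mxE -polyCM; congr (_%:P); ring.
Qed.

Lemma tr_outer x y : (outer x y)^T = outer y x.
Proof. by apply/matrixP => a b; rewrite !mxE mulrC. Qed.

(* Inverse of the loop sending y to t^-1 y + c x and x to - t x, and fixing the
   vectors orthogonal to x and y. *)
Definition neighbour_mx (c : C) x y : 'M[{poly C}]_n :=
  - outer x y + 'X *: (1%:M + c%:P *: outer x x - outer x y - outer y x)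
  + 'X^2 *: outer y x.

Definition neighbour c x y : lmx := LMx 1 (neighbour_mx c x y).

Lemma neighbour_twisted (c : C) x y : dot x x = 0 -> dot y y = 0 -> dot x y = 1 ->
  twisted (neighbour c x y).
Proof.
move=> xx yy xy; have yx : dot y x = 1 by rewrite dotC.
apply: twisted_of_left; rewrite /= expr1 /neighbour_mx.
(* The t^0 coefficient of the loop. Constant and symmetric, it is fixed by t -> -t and by
   transposition, while transposition swaps the two outer products. *)
set S := 1%:M + _ - _ - _.
have negS : mx_negt S = S.
  apply/matrixP => a b; rewrite !mxE !(comp_polyD, comp_polyN, comp_polyM, comp_polyC).
  by case: (a == b); rewrite ?mulr1n ?mulr0n -?polyC1 ?comp_poly0 ?comp_polyC.
have trS : S^T = S.
  by rewrite /S !linearB /= linearD linearZ /= trmx1 !tr_outer addrAC.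
have AS : outer x y *m S = c%:P *: outer x x.
  rewrite /S !mulmxBr mulmxDr mulmx1 -scalemxAr !outerM yx yy !scale1r scale0r.
  by rewrite subr0 addrAC subrr add0r.
have SB : S *m outer y x = c%:P *: outer x x.
  by rewrite -[LHS]trmxK trmx_mul trS tr_outer AS linearZ /= tr_outer.
have SA : S *m outer x y = 0.
  rewrite /S !mulmxBl mulmxDl mul1mx -scalemxAl !outerM yx xx !scale1r !scale0r scaler0.
  by rewrite addr0 subrr ?subr0.
have BS : outer y x *m S = 0.
  by rewrite -[LHS]trmxK trmx_mul trS tr_outer SA trmx0.
(* The two outer products missing here are supplied by their own squares, so that the middle
   coefficient of the product is the identity. *)
have SS : S *m S = 1%:M - outer x y - outer y x.
  rewrite {2}/S !mulmxBr mulmxDr mulmx1 -scalemxAr SA SB subr0.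
  have -> : S *m outer x x = 0.
    rewrite /S !mulmxBl mulmxDl mul1mx -scalemxAl !outerM yx xx.
    by rewrite scale1r !scale0r scaler0 addr0 subrr ?subr0.
  by rewrite scaler0 addr0 /S; apply/matrixP => a b; rewrite !mxE; ring.
move: S negS trS AS SB SA BS SS => S negS trS AS SB SA BS SS.
have -> : mx_negt (- outer x y + 'X *: S + 'X^2 *: outer y x)
    = - outer x y - 'X *: S + 'X^2 *: outer y x.
  apply/matrixP => a b; have /matrixP/(_ a b) := negS; rewrite !mxE => E.
  rewrite expr2 !(comp_polyD, comp_polyN, comp_polyM, comp_polyC, comp_polyX) E.
  by rewrite mulrNN mulNr.
have -> : (- outer x y + 'X *: S + 'X^2 *: outer y x)^T
    = - outer y x + 'X *: S + 'X^2 *: outer x y.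
  by rewrite !linearD !linearZ /= linearN /= trS !tr_outer.
rewrite !mulmxDl !mulmxDr !(mulNmx, mulmxN) -!scalemxAl -!scalemxAr AS SB SA BS SS.
rewrite !outerM xx yy xy yx; apply/matrixP => a b; rewrite !mxE.
by case: (a == b); rewrite ?mulr1n ?mulr0n; ring.
Qed.

Lemma neighbour_act (c : C) x y f k a :
  lmx_act (neighbour c x y) f k a =
    f k a - x a * dot y (f (k + 1)) + x a * (c * dot x (f k) - dot y (f k))
    - y a * dot x (f k) + y a * dot x (f (k - 1)).
Proof.
transitivity (\sum_b ((a == b)%:R * f k b - x a * (y b * f (k + 1) b)
    + x a * (c * (x b * f k b) - y b * f k b) - y a * (x b * f k b)
    + y a * (x b * f (k - 1) b))).
  apply: eq_bigr => b _; rewrite -[LHS]/(act _ (f^~ b) _).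
  have -> : neighbour_mx c x y a b = (- (x a * y b)) *: 'X^0
     + ((a == b)%:R + c * (x a * x b) - x a * y b - y a * x b) *: 'X^1
     + (y a * x b) *: 'X^2.
    rewrite !mxE expr0 expr1 -!mul_polyC !(polyCD, polyCN, polyCM).
    by case: (a == b); rewrite ?mulr1n ?mulr0n ?polyC0 ?polyC1; ring.
  rewrite !(actD, actZ, actXn) subr0 addrK (_ : k + 1 - 2 = k - 1); last by lia.
  by ring.
have delta : \sum_b (a == b)%:R * f k b = f k a.
  rewrite (bigD1 a) //= eqxx mul1r big1 ?addr0 // => b ba.
  by rewrite eq_sym (negPf ba) mul0r.
by rewrite !(big_split, sumrN) /= -!mulr_sumr sumrB -mulr_sumr delta.
Qed.

Lemma subspaceB W f h : subspace W -> W f -> W h -> W (fun k a => f k a - h k a).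
Proof.
move=> [_ [_ [WD WZ]]] Wf Wh.
have -> : (fun k a => f k a - h k a) = (fun k a => f k a + -1 * h k a).
  by apply/funext => k; apply/funext => a; rewrite mulN1r.
by apply: WD => //; apply: WZ.
Qed.

Lemma subspace_lincomb W d (c : 'I_d -> C) (w : 'I_d -> LS) :
  subspace W -> (forall i, W (w i)) -> W (lincomb c w).
Proof.
move=> [_ [W0 [WD WZ]]]; elim: d c w => [|d IH] c w Ww.
  rewrite (_ : lincomb c w = fun _ _ => 0) //.
  by apply/funext => k; apply/funext => a; rewrite /lincomb big_ord0.
have -> : lincomb c w = fun k a => c ord0 * w ord0 k a
    + lincomb (fun i => c (lift ord0 i)) (fun i => w (lift ord0 i)) k a.
  by apply/funext => k; apply/funext => a; rewrite /lincomb big_ord_recl.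
by apply: WD; [apply: WZ | apply: IH].
Qed.

(** Steinitz exchange: the multiple [b i / c i] of the second combination cancels the vector of
    index [i]. *)
Lemma lincomb_exchange d (c b : 'I_d.+1 -> C) (w : 'I_d.+1 -> LS) i k a :
  c i != 0 ->
  lincomb (fun j => b (lift i j) - b i / c i * c (lift i j)) (fun j => w (lift i j)) k a
  = lincomb b w k a - b i / c i * lincomb c w k a.
Proof.
move=> ci0; rewrite /lincomb [in RHS](bigD1_ord i) //= [X in _ - _ * X](bigD1_ord i) //=.
rewrite mulrDr mulrA divfK // opprD addrACA subrr add0r mulr_sumr -sumrB.
by apply: eq_bigr => j _; ring.
Qed.

(** Multiply [f] by t, which stays in [W], and stop just before a power series is reached. *)
Lemma exists_simple_pole W f : selfdual W -> W f -> ~ vanish 0 f ->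
  exists w, [/\ W w, vanish (-1) w & ~ vanish 0 w].
Proof.
move=> [[Wl _] Wt _ _] Wf; have [N] := laurent_vanish (Wl _ Wf).
elim: N f Wf => [|N IH] f Wf f0 nf; first by case: nf; rewrite -oppr0.
have [tf0|ntf] := pselect (vanish 0 (tmul f)).
  exists f; split=> // k k_lt a.
  by have := tf0 (k + 1) _ a; rewrite /tmul addrK; apply; lia.
apply: (IH (tmul f)) => //; first exact: Wt.
by move=> k k_lt a; apply: f0; lia.
Qed.

Lemma res_form1 u v : res_form 1 u v = \sum_a (u (-1) a * v 0 a - u 0 a * v (-1) a).
Proof.
apply: eq_bigr => a _; rewrite /res_window big_ord_recl big_ord1 /=.
rewrite (_ : (bump 0 0)%:Z - 1 = 0) // sub0r subrr subr0 expr0z mul1r.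
by rewrite exprN1 invrN1 mulN1r mulrN.
Qed.

(** The Hermitian norm of [y] is nonzero although [dot y y] is zero; conjugating the latter makes
    the rescaled conjugate of [y] isotropic. *)
Lemma isotropic_dual y : (exists a, y a != 0) -> dot y y = 0 ->
  exists x, dot x x = 0 /\ dot x y = 1.
Proof.
move=> [a0 ya0] yy; pose q : C := \sum_a `|y a| ^+ 2.
have q0 : q != 0.
  rewrite psumr_neq0 => [|a _]; last exact: exprn_ge0.
  by apply/hasP; exists a0; rewrite ?mem_index_enum //= exprn_gt0 // normr_gt0.
exists (fun a => (y a)^*%C / q); split.
  have -> : 0 = (dot y y)^*%C / q ^+ 2 by rewrite yy conjc0 mul0r.
  rewrite rmorph_sum mulr_suml; apply: eq_bigr => a _.
  by rewrite rmorphM /= mulf_div expr2.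
rewrite /dot; under eq_bigr => a _ do rewrite mulrAC [_ * y a]mulrC -normCK.
by rewrite -mulr_suml divff.
Qed.

Lemma descent_step W : selfdual W -> (exists f, W f /\ ~ vanish 0 f) ->
  exists K w, [/\ twisted K, W w, ~ vanish 0 w, vanish 0 (lmx_act K w)
    & forall f, W f -> vanish 0 f -> vanish 0 (lmx_act K f)].
Proof.
move=> sW [f [Wf nf]]; have [w [Ww w1 nw]] := exists_simple_pole sW Wf nf.
have [Wsub Wt Wiso Wmax] := sW.
pose y := w (-1).
(* In the pairing of [w] with t [w] only the leading coefficient survives, paired with itself. *)
have yy : dot y y = 0.
  have tw0 : vanish (-1) (tmul w) by move=> k k_lt a; apply: w1; lia.
  have /(form_zeroP (N := 1) w1 tw0) := Wiso _ _ Ww (Wt _ Ww).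
  rewrite res_form1 => <-; apply: eq_bigr => a _.
  by rewrite /tmul sub0r [w (-1 - 1) a]w1 // mulr0 subr0.
have y0 : exists a, y a != 0.
  apply: contrapT => ny; apply: nw => k k_lt a.
  have [k_lt1|->] : k < -1 \/ k = -1 by lia.
    exact: w1.
  by apply/eqP; apply: contrapT => /negP ya; apply: ny; exists a.
have [x [xx xy]] := isotropic_dual y0 yy.
(* Chosen to cancel the t^-1 coefficient of the image of [w]; the t^-2 coefficient is a multiple of
   [dot y y]. *)
pose c := dot y (w 0).
exists (neighbour c x y), w; split=> //.
- exact: neighbour_twisted.
- have dot0 z k : k < -1 -> dot z (w k) = 0.
    by move=> k_lt; apply: big1 => a _; rewrite w1 ?mulr0.
  move=> k k_lt a; rewrite neighbour_act.
  have [k_lt2|[->|->]] : k < -2 \/ k = -2 \/ k = -1 by lia.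
  + rewrite w1 ?(dot0 _ (k + 1)) ?(dot0 _ k) ?(dot0 _ (k - 1)); try lia.
    by ring.
  + by rewrite w1 // (_ : w (-2 + 1) = y) // !(dot0 _ (-2)) // (dot0 _ (-2 - 1)) // yy; ring.
  + rewrite (dot0 _ (-1 - 1)) // (_ : w (-1 + 1) = w 0) // -/y -/c yy xy; ring.
- move=> h Wh h0 k k_lt a.
  (* The loop could create a pole only through this number, which is up to sign the pairing of [h]
     with [w]. *)
  have yh : dot y (h 0) = 0.
    have h1 : vanish (-1) h by apply: vanish_le h0; lia.
    have /(form_zeroP (N := 1) h1 w1) := Wiso _ _ Wh Ww.
    rewrite res_form1 => /eqP; rewrite -oppr_eq0 => /eqP <-; rewrite -sumrN.
    by apply: eq_bigr => b _; rewrite [h (-1) b]h0 // mul0r sub0r opprK mulrC.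
  have dot0 z l : l < 0 -> dot z (h l) = 0.
    by move=> l_lt; apply: big1 => b _; rewrite h0 ?mulr0.
  rewrite neighbour_act h0 // !(dot0 _ k) // (dot0 _ (k - 1)); last by lia.
  have -> : dot y (h (k + 1)) = 0.
    have [k_lt1|->] : k + 1 < 0 \/ k + 1 = 0 by lia.
      exact: dot0.
    exact: yh.
  by ring.
Qed.

(** Nested self-orthogonal spaces coincide: H_n^(0) is isotropic, hence orthogonal to [W], hence
    inside [W]. The identity loop then works. *)
Lemma orbit_sub_vanish0 W : selfdual W -> (forall f, W f -> vanish 0 f) ->
  exists g, twisted g /\
    forall f, W f <-> exists h, vanish 0 h /\ f = lmx_act g h.
Proof.
move=> [_ _ _ Wmax] W0; exists (LMx 0 1%:M); split; first exact: twisted1.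
have id1 f : lmx_act (LMx 0 1%:M) f = f by rewrite -[1%:M]/(('X^0)%:M) lmx_act_scalar.
move=> f; split=> [/W0 f0|[h [h0 ->]]]; first by exists f; rewrite id1.
rewrite id1; apply: Wmax => [|u /W0 u0]; first exact: vanish_laurent h0.
by have [_ _ iso _] := selfdual_vanish0 R n; apply: iso.
Qed.

(* Induction on the number of vectors spanning W modulo H_n^(0): the vector v with
   K v in H_n^(0) replaces one of them, and is lost when passing from W to K W. *)
Lemma orbit_of_selfdual d W (w : 'I_d -> LS) :
  selfdual W -> (forall i, W (w i)) ->
  (forall f, W f -> exists c, vanish 0 (fun k a => f k a - lincomb c w k a)) ->
  exists g, twisted g /\
    forall f, W f <-> exists h, vanish 0 h /\ f = lmx_act g h.
Proof.
elim: d W w => [|d IH] W w sW Ww span.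
  apply: orbit_sub_vanish0 => // f /span[c fc] k k_lt a.
  by have := fc k k_lt a; rewrite /lincomb big_ord0 subr0.
have [W0|nW] := pselect (forall f, W f -> vanish 0 f); first exact: orbit_sub_vanish0.
have [Wsub _ Wiso Wmax] := sW.
have [|K [v [tK Wv nv Kv KW]]] := descent_step sW.
  by apply: contrapT => nf; apply: nW => f Wf; apply: contrapT => nf0; apply: nf; exists f.
have [c vc] := span _ Wv.
(* Otherwise [v] itself would be a power series. *)
have [i ci] : exists i, c i != 0.
  apply: contrapT => nc; apply: nv => k k_lt a; rewrite -(vc k k_lt a) /lincomb.
  rewrite big1 ?subr0 // => i _; have [->|ci] := eqVneq (c i) 0; first exact: mul0r.
  by case: nc; exists i.
(* The induction runs on K W, the preimage of [W] under [lmx_adj K], with the images of the vectors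
   other than [w i]. *)
have [||g' [tg' Wg']] := IH _ (fun j => lmx_act K (w (lift i j)))
    (selfdual_pullback (twisted_adj tK) sW).
- by move=> j; rewrite lmx_actK.
- move=> f Wf; have [b fb] := span _ Wf; set f' := lmx_act _ f in Wf fb.
  exists (fun j => b (lift i j) - b i / c i * c (lift i j)).
  (* The two remainders lie in [W] and in H_n^(0), so [K] keeps them in H_n^(0); [K v] lies there
     too. *)
  have -> : (fun k a => f k a - lincomb (fun j => b (lift i j) - b i / c i * c (lift i j))
      (fun j => lmx_act K (w (lift i j))) k a) =
    (fun k a => lmx_act K (fun k a => f' k a - lincomb b w k a) k a + b i / c i *
     (lmx_act K v k a - lmx_act K (fun k a => v k a - lincomb c w k a) k a)).
    have KB h1 h2 : lmx_act K (fun k a => h1 k a - h2 k a)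
        = fun k a => lmx_act K h1 k a - lmx_act K h2 k a.
      have -> : (fun k a => h1 k a - h2 k a) = (fun k a => h1 k a + -1 * h2 k a).
        by apply/funext => k; apply/funext => a; rewrite mulN1r.
      rewrite lmx_actD lmx_actZ.
      by apply/funext => k; apply/funext => a; rewrite mulN1r.
    rewrite !KB !lmx_act_lincomb lmx_adjK //.
    apply/funext => k; apply/funext => a.
    rewrite (lincomb_exchange b (fun i => lmx_act K (w i)) k a ci); ring.
  have vB : vanish 0 (lmx_act K (fun k a => f' k a - lincomb b w k a)).
    by apply: KW => //; apply: subspaceB => //; apply: subspace_lincomb.
  have vC : vanish 0 (lmx_act K (fun k a => v k a - lincomb c w k a)).
    by apply: KW => //; apply: subspaceB => //; apply: subspace_lincomb.
  by move=> k k_lt a; rewrite vB // vC // Kv // subrr mulr0 addr0.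
exists (lmx_mul (lmx_adj K) g'); split; first exact: twistedM (twisted_adj tK) tg'.
move=> f; rewrite -[f in W f](lmx_actK f tK) Wg'; split=> -[h [h0 E]]; exists h; split=> //.
  by rewrite lmx_actM -E lmx_actK.
by rewrite E lmx_actM lmx_adjK.
Qed.

End Descent.

(** * Dimension counts in a finite window and along the filtration H_n^(j) *)

Section Dimension.
Variables (R : realType) (n : nat).
Local Notation C := (R[i]).
Local Notation LS := (LS R n).
Implicit Types (f h u v : LS) (W : LS -> Prop) (N : nat).

Local Notation window N := ('I_(N + N) * 'I_n)%type.

Definition coords N f : 'rV[C]_#|{: window N}| :=
  \row_(s < #|{: window N}|) f ((enum_val s).1%:Z - N%:Z) (enum_val s).2.

(** The exponents are reflected and signed so that the residue form becomes the ordinary product of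
    two rows. *)
Definition dual_coords N f : 'rV[C]_#|{: window N}| :=
  \row_(s < #|{: window N}|) (let q : int := - 1 - ((enum_val s).1%:Z - N%:Z) in
          (-1) ^ q * f q (enum_val s).2).

Lemma res_form_coords N u v :
  res_form N u v = (coords N u *m (dual_coords N v)^T) 0 0.
Proof.
rewrite /res_form exchange_big pair_big mxE /=.
rewrite (big_enum_val (fun s : window N => u (s.1%:Z - N%:Z) s.2 *
  ((-1) ^ (- 1 - (s.1%:Z - N%:Z)) * v (- 1 - (s.1%:Z - N%:Z)) s.2))) /=.
by apply: eq_bigr => s _; rewrite !mxE.
Qed.

Lemma coords_lincomb N d (c : 'I_d -> C) (w : 'I_d -> LS) :
  coords N (lincomb c w) = \row_i c i *m \matrix_i coords N (w i).
Proof. by apply/rowP => s; rewrite !mxE; apply: eq_bigr => i _; rewrite !mxE. Qed.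

Lemma dual_coords_lincomb N d (c : 'I_d -> C) (w : 'I_d -> LS) :
  dual_coords N (lincomb c w) = \row_i c i *m \matrix_i dual_coords N (w i).
Proof.
apply/rowP => s; rewrite !mxE /= mulr_sumr; apply: eq_bigr => i _.
by rewrite !mxE mulrCA.
Qed.

Lemma coordsB N f h : coords N (fun k a => f k a - h k a) = coords N f - coords N h.
Proof. by apply/rowP => s; rewrite !mxE. Qed.

Lemma dual_coordsB N f h :
  dual_coords N (fun k a => f k a - h k a) = dual_coords N f - dual_coords N h.
Proof. by apply/rowP => s; rewrite !mxE /= mulrBr. Qed.

Lemma coords_eq0 N f : vanish (- N%:Z) f -> coords N f = 0 <-> vanish N f.
Proof.
move=> f0; split=> [cf k k_lt a|fN]; last first.
  by apply/rowP => s; rewrite !mxE fN //; case: (enum_val s).1 => i /=; lia.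
have [|k_ge] := ltP k (- N%:Z); first by move/f0.
have lt_i : (absz (k + N%:Z)%R < N + N)%N by lia.
have /rowP/(_ (enum_rank (Ordinal lt_i, a))) := cf.
by rewrite !mxE enum_rankK /= => <-; congr f; lia.
Qed.

Lemma dual_coords_eq0 N f : vanish (- N%:Z) f -> dual_coords N f = 0 <-> vanish N f.
Proof.
move=> f0; split=> [cf k k_lt a|fN]; last first.
  by apply/rowP => s; rewrite !mxE /= fN ?mulr0 //; case: (enum_val s).1 => i /=; lia.
have [|k_ge] := ltP k (- N%:Z); first by move/f0.
have lt_i : (absz (N%:Z - 1 - k)%R < N + N)%N by lia.
have /rowP/(_ (enum_rank (Ordinal lt_i, a))) := cf.
rewrite !mxE enum_rankK /= => /eqP.
rewrite mulf_eq0 expfz_eq0 oppr_eq0 oner_eq0 andbF /= => /eqP <-.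
by congr f; lia.
Qed.

Lemma vanish_lincomb (s : int) d (c : 'I_d -> C) (w : 'I_d -> LS) :
  (forall i, vanish s (w i)) -> vanish s (lincomb c w).
Proof. by move=> w0 k k_lt a; apply: big1 => i _; rewrite w0 ?mulr0. Qed.

Lemma vanishB (s : int) f h :
  vanish s f -> vanish s h -> vanish s (fun k a => f k a - h k a).
Proof. by move=> f0 h0 k k_lt a; rewrite f0 ?h0 ?subr0. Qed.

Lemma coords_surj N (r : 'rV[C]_#|{: window N}|) :
  exists f, vanish (- N%:Z) f /\ coords N f = r.
Proof.
pose m s := @mono R n ((@enum_val _ {: window N} s).1%:Z - N%:Z) (enum_val s).2.
exists (lincomb (r 0) m); split.
  by apply: vanish_lincomb => s; apply: vanish_le (@vanish_mono _ _ _ _); lia.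
rewrite coords_lincomb -[RHS]mulmx1; congr (_ *m _).
  by apply/rowP => s; rewrite mxE.
apply/matrixP => s s'; rewrite !mxE /m /mono; congr ((nat_of_bool _)%:R); apply/idP/idP.
  case/andP=> /eqP e1 /eqP e2; apply/eqP/enum_val_inj; move: e1 e2.
  case: (enum_val s) (enum_val s') => i a [j b] /= e1 <-.
  by congr (_, _); apply: val_inj => /=; lia.
by move/eqP->; rewrite !eqxx.
Qed.

(** For k < -N the monomials of exponent -1-k lie in t^N H_n^(0), hence in [W], and detect the
    coefficient of t^k. *)
Lemma orth_vanish W N f : (forall h, vanish N h -> W h) ->
  laurent f -> (forall u, W u -> form_zero f u) -> vanish (- N%:Z) f.
Proof.
move=> NW lf f_orth k k_lt a.
rewrite (_ : k = -1 - (-1 - k)); last by lia.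
apply: form_zero_mono => //; apply/f_orth/NW.
by apply: vanish_le (@vanish_mono _ _ _ _); lia.
Qed.

(* The window pairs its 2Nn coordinates perfectly, so an isotropic W is its own
   orthogonal exactly when it has half the dimension. *)
Lemma selfdual_quot_dim W N d : subspace W ->
  (forall u v, W u -> W v -> form_zero u v) ->
  (forall h, vanish N h -> W h) -> quot_dim W (- (N%:Z * n%:Z)) d ->
  (forall f, laurent f -> (forall u, W u -> form_zero f u) -> W f) <->
  d = (N * n)%N.
Proof.
move=> Wsub Wiso NW [w [Ww [indep span]]]; have [Wl [_ [WD _]]] := Wsub.
have WN f : W f -> vanish (- N%:Z) f.
  by move=> Wf; apply: (orth_vanish NW) => [|u Wu]; [apply: Wl | apply: Wiso].
have wN c : vanish (- N%:Z) (lincomb c w).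
  by apply: vanish_lincomb => i; apply: WN.
(* The rows of [U] represent [W] modulo t^N H_n^(0), and the kernel of [V^T] represents its
   orthogonal. *)
pose U := \matrix_i coords N (w i); pose V := \matrix_i dual_coords N (w i).
have lincombE (c : 'rV[C]_d) : \row_i c 0 i = c by apply/rowP => i; rewrite mxE.
have U_free : row_free U.
  apply: inj_row_free => c; rewrite -(lincombE c) -coords_lincomb.
  move/(coords_eq0 (wN _))/Hj_vanish/indep => c0.
  by apply/rowP => i; rewrite !mxE c0.
have V_free : row_free V.
  apply: inj_row_free => c; rewrite -(lincombE c) -dual_coords_lincomb.
  move/(dual_coords_eq0 (wN _))/Hj_vanish/indep => c0.
  by apply/rowP => i; rewrite !mxE c0.
have rV i : row i V = dual_coords N (w i) by rewrite rowK.
have orthP f : vanish (- N%:Z) f ->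
    coords N f *m V^T = 0 <-> forall i, form_zero f (w i).
  move=> f0; have E i : (coords N f *m V^T) 0 i = res_form N f (w i).
    by rewrite res_form_coords !mxE; apply: eq_bigr => s _; rewrite !mxE.
  split=> [/rowP fV i|f_orth].
    by apply/(form_zeroP f0 (WN _ (Ww i))); rewrite -E fV mxE.
  by apply/rowP => i; rewrite E mxE; apply/(form_zeroP f0 (WN _ (Ww i))).
have UK : (U <= kermx V^T)%MS.
  apply/row_subP => i; apply/sub_kermxP; rewrite rowK.
  by apply/orthP => [|j]; [apply: WN | apply: Wiso].
(* With isotropy giving [U] inside the kernel, self-orthogonality amounts to equality of the ranks d
   and 2Nn - d. *)
have rankK : \rank (kermx V^T) = ((N + N) * n - d)%N.
  by rewrite mxrank_ker mxrank_tr (eqnP V_free) card_prod !card_ord.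
have rankU : \rank U = d by exact/eqnP.
have le_d : (d <= (N + N) * n)%N.
  by rewrite -(eqnP V_free) (leq_trans (rank_leq_col _)) // card_prod !card_ord.
have decomp u : W u -> exists c, vanish N (fun k a => u k a - lincomb c w k a).
  by move=> /span[c /Hj_vanish]; exists c.
split=> [Wmax|dE f lf f_orth].
  have KU : (kermx V^T <= U)%MS.
    apply/row_subP => i; have [f [f0 fE]] := coords_surj (row i (kermx V^T)).
    have f_orth : forall i, form_zero f (w i).
      by apply/orthP => //; rewrite fE -row_mul mulmx_ker row0.
    have /decomp[c fc] : W f.
      apply: Wmax => [|u Wu]; first exact: vanish_laurent f0.
      (* Modulo t^N H_n^(0), which the pairing with [f] does not see, [u] is a combination of the
         [w i]. *)
      have [c uc] := decomp u Wu.
      apply/(form_zeroP f0 (WN _ Wu)); rewrite res_form_coords.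
      have -> : dual_coords N u = \row_i c i *m V.
        rewrite -dual_coords_lincomb; apply/eqP; rewrite -subr_eq0 -dual_coordsB.
        by apply/eqP/dual_coords_eq0 => //; apply: vanishB => //; apply: WN.
      by rewrite trmx_mul mulmxA ((orthP f f0).2 f_orth) mul0mx mxE.
    rewrite -fE; apply/submxP; exists (\row_i c i); rewrite -coords_lincomb.
    apply/eqP; rewrite -subr_eq0 -coordsB.
    by apply/eqP/coords_eq0 => //; apply: vanishB.
  have := mxrankS UK; have := mxrankS KU; rewrite rankK rankU mulnDl; lia.
have f0 := orth_vanish NW lf f_orth.
have /submxP[c fc] : (coords N f <= U)%MS.
  have : (kermx V^T <= U)%MS.
    by rewrite -(geq_leqif (mxrank_leqif_sup UK)) rankK rankU dE mulnDl addnK.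
  by apply: submx_trans; apply/sub_kermxP/orthP => // i; apply: f_orth.
have -> : f = fun k a => (f k a - lincomb (c 0) w k a) + lincomb (c 0) w k a.
  by apply/funext => k; apply/funext => a; rewrite subrK.
apply: WD; last exact: subspace_lincomb.
apply: NW; apply/coords_eq0; first exact: vanishB.
by rewrite coordsB fc coords_lincomb lincombE subrr.
Qed.

(** A longest family in [W] with independent coordinates is a basis of the quotient; its length is
    bounded by the size of the window. *)
Lemma exists_quot_dim W N : subspace W -> (forall f, W f -> vanish (- N%:Z) f) ->
  exists d, quot_dim W (- (N%:Z * n%:Z)) d.
Proof.
move=> Wsub WN.
pose indep d := exists w : 'I_d -> LS,
  (forall i, W (w i)) /\ row_free (\matrix_i coords N (w i)).
have ex_indep : exists d, `[< indep d >].
  exists 0%N; apply/asboolP; exists (fun _ _ _ => 0).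
  by split=> [[]//|]; apply: inj_row_free => v _; apply/rowP => -[].
have ub_indep d : `[< indep d >] -> (d <= #|{: window N}|)%N.
  by move=> /asboolP[w [_ /eqnP <-]]; apply: rank_leq_col.
have [d /asboolP[w [Ww w_free]] d_max] := ex_maxnP ex_indep ub_indep.
have wN c : vanish (- N%:Z) (lincomb c w).
  by apply: vanish_lincomb => i; apply: WN.
exists d, w; split=> //; split=> [c /Hj_vanish/(coords_eq0 (wN _))|f Wf].
  rewrite coords_lincomb => /eqP; rewrite mulmx_free_eq0 // => /eqP/rowP c0 i.
  by have := c0 i; rewrite !mxE.
have [/submxP[c fc]|nf] := boolP (coords N f <= \matrix_i coords N (w i))%MS.
  exists (c 0); apply/Hj_vanish/coords_eq0; first by apply: vanishB => //; apply: WN.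
  rewrite coordsB fc coords_lincomb (_ : \row_i c 0 i = c) ?subrr //.
  by apply/rowP => i; rewrite mxE.
(* An element outside the span could be adjoined at index 0, against maximality. *)
suff /asboolP/d_max : indep d.+1 by rewrite ltnn.
exists (fun i => oapp w f (unlift ord0 i)); split=> [i|]; first by case: unliftP => [j _|_] /=.
apply: inj_row_free => c; rewrite mulmx_sum_row big_ord_recl rowK unlift_none /=.
under eq_bigr => i _ do rewrite rowK liftK /=.
move=> c0; have c00 : c 0 ord0 = 0.
  apply: contraNeq nf => nc0.
  rewrite -[coords N f](scalerK nc0) (canRL (addrK _) c0) sub0r.
  apply/scalemx_sub; rewrite eqmx_opp; apply: summx_sub => i _.
  by apply/scalemx_sub; rewrite -[coords N _](rowK (fun i => coords N (w i))) row_sub.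
apply/rowP => i; rewrite mxE; case: (unliftP ord0 i) => [j ->|-> //].
have : \row_j c 0 (lift ord0 j) *m \matrix_i coords N (w i) == 0.
  rewrite -c0 c00 scale0r add0r mulmx_sum_row; apply/eqP.
  by apply: eq_bigr => l _; rewrite rowK mxE.
by rewrite mulmx_free_eq0 // => /eqP/rowP/(_ j); rewrite !mxE.
Qed.

(** Consecutive steps of the filtration differ by one basis vector, so the quotient loses one
    dimension. This reaches the indices that are not multiples of [n]. *)
Lemma quot_dim_pred W m : (0 < n)%N -> subspace W ->
  (forall f, Hj (- m%:Z) f -> W f) ->
  quot_dim W (- m.+1%:Z) m.+1 -> quot_dim W (- m%:Z) m.
Proof.
move=> n_gt0 Wsub mW [w [Ww [indep span]]].
(* Euclidean division of [m] by [n] locates the unique basis vector lying in H_n^(-m) but not in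
   H_n^(-m-1). *)
have [k0 [a0 k0a0]] : exists (k0 : int) (a0 : 'I_n),
    - (n%:Z * (k0 + 1)) + a0%:Z = - m.+1%:Z.
  have lt_r : (n.-1 - m %% n < n)%N by lia.
  exists (m %/ n)%N%:Z, (Ordinal lt_r) => /=.
  by have := divn_eq m n; have := ltn_pmod m n_gt0; nia.
have idx_inj (k : int) (a : 'I_n) :
    - (n%:Z * (k + 1)) + a%:Z = - m.+1%:Z -> k = k0 /\ a = a0.
  move=> ka; have kk : k = k0.
    by have := ltn_ord a; have := ltn_ord a0; nia.
  by split=> //; apply: val_inj => /=; subst k; lia.
pose v := @mono R n k0 a0.
have HjS f : Hj (- m%:Z) f -> Hj (- m.+1%:Z) (fun k a => f k a - f k0 a0 * v k a).
  move=> Hf k a; rewrite /v /mono.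
  have [/andP[/eqP -> /eqP ->]|nka] := boolP ((k == k0) && (a == a0)).
    by rewrite mulr1 subrr eqxx.
  rewrite mulr0 subr0 => /Hf; rewrite lt_neqAle => ka.
  have : - (n%:Z * (k + 1)) + a%:Z != - m.+1%:Z.
    by apply: contraNneq nka => /idx_inj[-> ->]; rewrite !eqxx.
  by lia.
have HjW f : Hj (- m.+1%:Z) f -> Hj (- m%:Z) f.
  by move=> Hf k a /Hf; lia.
have HjD (s : int) f h (b : C) : Hj s f -> Hj s h -> Hj s (fun k a => f k a - b * h k a).
  move=> Hf Hh k a fh; have [/eqP f0|/Hf //] := boolP (f k a == 0).
  have [/eqP h0|/Hh //] := boolP (h k a == 0).
  by move: fh; rewrite f0 h0 mulr0 subrr eqxx.
have Hv : Hj (- m%:Z) v.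
  move=> k a; rewrite /v /mono; case: andP => [[/eqP -> /eqP ->] _|]; last by rewrite eqxx.
  by rewrite k0a0; lia.
have [c vc] := span _ (mW _ Hv).
have [i ci] : exists i, c i != 0.
  apply: contrapT => nc.
  have := vc k0 a0; rewrite k0a0 ltxx /lincomb big1 => [|i _].
    by rewrite subr0 /v /mono !eqxx oner_eq0 => /(_ isT).
  have [->|ci] := eqVneq (c i) 0; first exact: mul0r.
  by case: nc; exists i.
exists (fun j => w (lift i j)); split; first by move=> j; apply: Ww.
split=> [b /HjS|f Wf].
  set x := lincomb b _ k0 a0 => Hb.
  (* Extend [b] by zero at [i] and replace [v] by its expansion [c]: the coefficient at [i] becomes
     - x c_i, which forces x = 0. *)
  pose b' j := oapp b 0 (unlift i j).
  have b'E k a : lincomb b (fun j => w (lift i j)) k a = lincomb b' w k a.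
    rewrite /lincomb [RHS](bigD1_ord i) //= {1}/b' unlift_none mul0r add0r.
    by apply: eq_bigr => j _; rewrite /b' liftK.
  have /indep b'0 : Hj (- m.+1%:Z) (lincomb (fun j => b' j - x * c j) w).
    have := HjD _ _ _ (- x) Hb vc; congr Hj; apply/funext => k; apply/funext => a.
    rewrite b'E; have -> : lincomb (fun j => b' j - x * c j) w k a
        = lincomb b' w k a - x * lincomb c w k a.
      rewrite /lincomb mulr_sumr -sumrB; apply: eq_bigr => j _; ring.
    by ring.
  have x0 : x = 0.
    have := b'0 i; rewrite /b' unlift_none /= sub0r => /eqP.
    by rewrite oppr_eq0 mulf_eq0 (negPf ci) orbF => /eqP.
  by move=> j; have := b'0 (lift i j); rewrite /b' liftK x0 mul0r subr0.
have [b fb] := span _ Wf.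
(* Exchange eliminates [w i] at the cost of a multiple of [v], which is zero modulo H_n^(-m). *)
exists (fun j => b (lift i j) - b i / c i * c (lift i j)).
have := HjD _ _ _ (- (b i / c i)) (HjD _ _ _ (b i / c i) (HjW _ fb) (HjW _ vc)) Hv.
congr Hj; apply/funext => k; apply/funext => a.
by rewrite lincomb_exchange //; ring.
Qed.

End Dimension.

Theorem theorem2 (R : realType) (n : nat) (n_gt0 : (0 < n)%N)
    (W : LS R n -> Prop) :
  gr2 W <->
  exists g : lmx R n, twisted g /\
    (forall f, W f <-> exists h, Hj 0 h /\ f = lmx_act g h).
Proof.
split=> [[[[Wsub [N HN]] Wt] [_ Wiso]]|[g [tg Wg]]].
  (* A multiple of [n] beyond the threshold, where the filtration is by powers of t. *)
  have [NW Nd] := HN _ (leq_pmulr N n_gt0).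
  rewrite PoszM in NW Nd.
  have {}NW h : vanish N h -> W h by move=> /Hj_vanish/NW.
  have Wmax := (selfdual_quot_dim Wsub Wiso NW Nd).2 erefl.
  have [w [Ww [_ span]]] := Nd.
  have [|g [tg Wg]] := @orbit_of_selfdual R n _ W w (And4 Wsub Wt Wiso Wmax) Ww.
    by move=> f /span[c /Hj_vanish fc]; exists c; apply: vanish_le fc.
  by exists g; split=> // f; rewrite Wg; split=> -[h [/Hj0_vanish h0 E]]; exists h.
(* The image of H_n^(0) under [g] is its preimage under the inverse loop. *)
have WE : W = fun f => vanish 0 (lmx_act (lmx_adj g) f).
  apply/funext => f; apply/propext; rewrite Wg; split=> [[h [/Hj0_vanish h0 ->]]|f0].
    by rewrite lmx_actK.
  by exists (lmx_act (lmx_adj g) f); split; [apply/Hj0_vanish | rewrite lmx_adjK].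
have sW : selfdual W.
  by rewrite WE; apply: selfdual_pullback (twisted_adj tg) (selfdual_vanish0 R n).
have [Wsub Wt Wiso Wmax] := sW; have [Wl _] := Wsub.
suff W0 : Gr0 W by split; split.
(* The inverse of [g] has poles of order at most [lmx_sh g], so [W] contains t^s H_n^(0) with s =
   [lmx_sh g]. *)
split=> //; exists (lmx_sh g * n)%N => m le_m.
have HmW m' : (m <= m')%N -> forall f, Hj (- m'%:Z) f -> W f.
  move=> le_m' f Hf; rewrite WE.
  have /Hj_vanish/(vanish_act (A := lmx_adj g)) :
    Hj (- ((lmx_sh g)%:Z * n%:Z)) f by move=> k a /Hf; lia.
  by rewrite subrr.
split; first exact: HmW.
(* The dimension is first computed at [m * n], where self-orthogonality determines it, then lowered
   one step at a time to [m]. *)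
have le_mn : (m <= m * n)%N by exact: leq_pmulr.
have NW h : vanish m h -> W h.
  by move=> /Hj_vanish; rewrite -PoszM; apply: HmW.
have [|d Wd] := @exists_quot_dim R n W m Wsub.
  by move=> f Wf; apply: (orth_vanish NW) => [|u]; [apply: Wl | apply: Wiso].
have dE := (selfdual_quot_dim Wsub Wiso NW Wd).1 Wmax.
rewrite dE -PoszM -(subnKC le_mn) in Wd.
elim: (m * n - m)%N Wd => [|e IH]; first by rewrite addn0.
rewrite addnS => /quot_dim_pred Wd; apply: IH; apply: Wd => //.
by apply: HmW; apply: leq_addr.
Qed.
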